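(* Let $G$ be a finite group which is not cyclic, and let $N\unlhd G$ be such that $|G:N|=p$ for some prime number $p$. Then $$m_{G,N}=\frac{1}{|G|}\sum_{C\leq N,\ C\text{ is cyclic}}\bigl(1-\chi(|N(\mathfrak{T}_{C}(G))|)\bigr)\cdot\varphi(|C|),$$ where the sum runs over all cyclic subgroups $C$ of $N$ (including the trivial one), $\varphi$ is the Euler totient function, and $\chi(|N(\mathfrak{T}_{C}(G))|)$ is the Euler characteristic of the space $|N(\mathfrak{T}_{C}(G))|$.
   Context: For a finite group $G$, $\mu$ denotes the Möbius function of the poset of all subgroups of $G$ ordered by inclusion. For $N\unlhd G$, $$m_{G,N}:=\frac{1}{|G|}\sum_{X\leq G,\ XN=G}|X|\,\mu(X,G).$$ For a cyclic subgroup $C$ of $N$, set $$\mathfrak{T}_{C}(G):=\{X \mid C\leq X\lneq G,\ X\nleq N\},$$ a poset of subgroups of $G$ ordered by inclusion, regarded as a category with one morphism $Y\to Z$ whenever $Y\leq Z$. $N(\mathfrak{T}_C(G))$ denotes the nerve of this category and $|N(\mathfrak{T}_C(G))|$ its geometric realization (the order complex of the poset: its $i$-simplices are the chains $X_0\lneq X_1\lneq\cdots\lneq X_i$ in $\mathfrak{T}_C(G)$). The Euler characteristic of a finite complex $K$ is $\chi(K)=\sum_i(-1)^i\,\mathrm{rank}(C_i(K))$, i.e. the alternating sum of the numbers of simplices of $K$ in each dimension $i\geq 0$ (so the empty complex has Euler characteristic $0$). *)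

(* Defs.v *)
From HB Require Import structures.
From mathcomp Require Import all_boot all_order all_algebra all_fingroup all_solvable.

Set Implicit Arguments.
Unset Strict Implicit.
Unset Printing Implicit Defensive.

Import Order.TTheory GRing.Theory Num.Theory.
Local Open Scope ring_scope.

Section FinitePosets.
Context {d : Order.disp_t} {T : finPOrderType d}.
Implicit Types (P : {set T}) (x y z : T).

(* Recursion on the length of chains below [y]; the fuel [n] only serves
   termination, see [mobiusE]. *)
Fixpoint mobius_rec P (n : nat) x y : int :=
  if n is n'.+1 then
    if x == y then 1
    else if (x < y)%O then
      - \sum_(z in P | (x <= z < y)%O) mobius_rec P n' x z
    else 0
  else 0.

(* The Moebius function of the subposet P of T, meaningful for x, y in P. *)
Definition mobius P x y : int := mobius_rec P #|P| x y.

Lemma mobius_rec_stable P n x y :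
  (#|[set z in P | (x <= z < y)%O]| <= n)%N ->
  mobius_rec P n.+1 x y = mobius_rec P n.+2 x y.
Proof.
elim: n y => [|n IHn] y le_n.
  have e0 z : (z \in P) && (x <= z < y)%O = false.
    move: le_n; rewrite leqn0 cards_eq0 => /eqP e.
    by have := in_set0 z; rewrite -e inE.
  by rewrite /=; case: ifP => // _; case: ifP => // _; rewrite !big_pred0.
rewrite [LHS]/= [RHS]/= -/(mobius_rec P n.+1) -/(mobius_rec P n.+2).
case: ifP => // _; case: ifP => // _; congr (- _).
apply: eq_bigr => z /andP[Pz /andP[xz zy]]; apply: IHn.
rewrite -ltnS; apply: leq_trans le_n; apply: proper_card.
apply/properP; split.
  apply/subsetP=> t; rewrite !inE => /and3P[-> -> tz] /=.
  exact: lt_trans tz zy.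
by exists z; rewrite !inE ?Pz ?xz ?zy ?ltxx ?andbF.
Qed.

Lemma mobiusE P x y : y \in P ->
  mobius P x y =
    if x == y then 1
    else if (x < y)%O then - \sum_(z in P | (x <= z < y)%O) mobius P x z
    else 0.
Proof.
move=> Py; rewrite /mobius.
have: (#|[set z in P | (x <= z < y)%O]| < #|P|)%N.
  apply: proper_card; apply/properP; split.
    by apply/subsetP=> t; rewrite !inE => /andP[].
  by exists y; rewrite // !inE ltxx !andbF.
case: #|P| => [//|n]; rewrite ltnS => le_n.
by rewrite mobius_rec_stable.
Qed.

Lemma mobius_xx P x : x \in P -> mobius P x x = 1.
Proof. by move=> Px; rewrite mobiusE // eqxx. Qed.

Lemma sum_mobius P x y : y \in P -> (x < y)%O ->
  \sum_(z in P | (x <= z <= y)%O) mobius P x z = 0.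
Proof.
move=> Py xy; rewrite (bigD1 y) /=; last by rewrite Py lexx (ltW xy).
rewrite {1}mobiusE // (lt_eqF xy) xy addrC; apply/eqP; rewrite subr_eq0.
apply/eqP/eq_bigl => z; rewrite lt_neqAle.
by case: (z \in P); case: (x <= z)%O; case: (z <= y)%O; case: (z == y).
Qed.

(* The i-simplices X_0 < ... < X_i of the order complex of P, i.e. the
   nondegenerate i-simplices of the nerve of P. *)
Definition simplices P (i : nat) : {set i.+1.-tuple T} :=
  [set c : i.+1.-tuple T | all [in P] c & sorted <%O c].

Lemma simplices_eq0 P i : (#|P| <= i)%N -> simplices P i = set0.
Proof.
move=> leP; apply/setP=> c; rewrite !inE; apply/negP=> /andP[/allP cP].
move=> /(sorted_uniq lt_trans ltxx) /card_uniqP; rewrite size_tuple => cc.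
have /subset_leq_card : c \subset P by apply/subsetP.
by rewrite cc leqNgt ltnS leP.
Qed.

(* By [simplices_eq0] the range covers all the dimensions. *)
Definition euler_char P : int :=
  \sum_(i < #|P|) (-1) ^+ i * #|simplices P i|%:Z.

End FinitePosets.

Section SubgroupOrder.
Variable gT : finGroupType.
Implicit Types X Y : {group gT}.

Fact subgroup_display : Order.disp_t. Proof. exact: Order.Disp tt tt. Qed.

Let leG : rel {group gT} := fun X Y => X \subset Y.
Let ltG : rel {group gT} := fun X Y => X \proper Y.

Fact ltG_def X Y : ltG X Y = (Y != X) && leG X Y.
Proof. by rewrite /ltG /leG properEneq eq_sym. Qed.

Fact leG_refl : reflexive leG. Proof. by move=> X; exact: subxx. Qed.

Fact leG_anti : antisymmetric leG.
Proof. by move=> X Y XY; apply/val_inj/eqP; rewrite eqEsubset. Qed.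

Fact leG_trans : transitive leG.
Proof. by move=> Y X Z; exact: subset_trans. Qed.

HB.instance Definition _ := Order.isPOrder.Build subgroup_display {group gT}
  ltG_def leG_refl leG_anti leG_trans.

Lemma le_groupE X Y : (X <= Y)%O = (X \subset Y). Proof. by []. Qed.
Lemma lt_groupE X Y : (X < Y)%O = (X \proper Y). Proof. by []. Qed.

End SubgroupOrder.

Section NormalSubgroupPair.
Variable gT : finGroupType.
Implicit Types C G N X : {group gT}.

Definition m_ratio G N : rat :=
  #|G|%:R^-1 *
  \sum_(X : {group gT} | (X \subset G) && ((X * N)%g == G))
     #|X|%:R * (mobius (subgroups G) X G)%:~R.

(* The notation T_C(G) leaves the dependence on N implicit. *)
Definition TC G N C : {set {group gT}} :=
  [set X : {group gT} | [&& C \subset X, X \proper G & ~~ (X \subset N)]].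

End NormalSubgroupPair.

(* Main.v *)
(** Since N is maximal in G, XN = G means that X is not contained in N. Writing
    |X| as the sum of phi(|C|) over the cyclic C <= X and exchanging sums, m_{G,N}
    becomes a sum over cyclic C <= G of phi(|C|) times the sum of mu(X,G) over the
    X >= C not contained in N. If C is not contained in N, this inner sum runs over
    the whole interval [C,G], and vanishes because C <> G. If C <= N, it runs over
    T_C(G) and G; as T_C(G) is upward closed below G, -mu(-,G) obeys on it the
    same recursion as the signed count of the chains with a given bottom element,
    so that the inner sum is 1 - chi(T_C(G)). *)
Require Import Defs.
From mathcomp Require Import all_boot all_order all_algebra all_fingroup all_solvable.
Set Implicit Arguments.
Unset Strict Implicit.
Unset Printing Implicit Defensive.

Import Order.TTheory GRing.Theory Num.Theory.
Local Open Scope ring_scope.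

Section MobiusEulerChar.
Context {d : Order.disp_t} {T : finPOrderType d}.
Implicit Types (P Q : {set T}) (x y z : T).

(** * Moebius inversion in the upper variable *)

Lemma mobius_eq0 P x y : y \in P -> ~~ (x <= y)%O -> mobius P x y = 0.
Proof.
move=> Py nxy; rewrite mobiusE //; case: eqP => [exy|_].
  by rewrite exy lexx in nxy.
by case: ifP => // /ltW xy; rewrite xy in nxy.
Qed.

(* The defining recursion says that the matrix of mu is a left inverse of the
   incidence matrix of P, hence it is also a right inverse. *)
Lemma sum_mobius_r P x y : x \in P -> y \in P -> (x < y)%O ->
  \sum_(z in P | (x <= z <= y)%O) mobius P z y = 0.
Proof.
move=> Px Py xy.
pose M : 'M[int]_#|P| := \matrix_(i, j) mobius P (enum_val i) (enum_val j).
pose Z : 'M[int]_#|P| := \matrix_(i, j) (enum_val i <= enum_val j)%O%:R.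
have MZ : M *m Z = 1%:M.
  apply/matrixP=> i j; rewrite !mxE.
  under eq_bigr do rewrite !mxE.
  rewrite -(big_enum_val
    (fun z => mobius P (enum_val i) z * (z <= enum_val j)%O%:R)) /=.
  have Pi := enum_valP i; have Pj := enum_valP j.
  rewrite (bigID (fun z => enum_val i <= z <= enum_val j)%O) /=.
  (* Outside the interval one of the two factors is zero. *)
  rewrite [X in _ + X]big1 ?addr0 => [|z /andP[Pz]]; last first.
    rewrite negb_and => /orP[/(mobius_eq0 Pz)->|/negPf->]; first exact: mul0r.
    exact: mulr0.
  under eq_bigr => z /and3P[_ _ ->] do rewrite mulr1.
  rewrite -(inj_eq enum_val_inj).
  case: eqVneq => [->|ne_ij].
    rewrite (big_pred1 (enum_val j)) ?mobius_xx // => z /=.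
    rewrite andbC -eq_le eq_sym.
    by case: eqVneq => [->|]; rewrite ?Pj.
  have [le_ij|nle_ij] := boolP (enum_val i <= enum_val j)%O.
    by apply: sum_mobius => //; rewrite lt_neqAle ne_ij.
  rewrite big_pred0 // => z; apply/negP=> /and3P[_ iz zj].
  by rewrite (le_trans iz zj) in nle_ij.
have /matrixP/(_ (enum_rank_in Px x) (enum_rank_in Px y)) := mulmx1C MZ.
rewrite !mxE -(inj_eq enum_val_inj) !enum_rankK_in // (lt_eqF xy) /= => ZM0.
apply: etrans ZM0.
under [RHS]eq_bigr do rewrite !mxE !enum_rankK_in //.
rewrite -(big_enum_val (fun z => (x <= z)%O%:R * mobius P z y)) /=.
rewrite [RHS](bigID (fun z => x <= z <= y)%O) /=.
rewrite [X in _ = _ + X]big1 ?addr0 => [|z /andP[Pz]]; last first.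
  rewrite negb_and => /orP[/negPf->|/(mobius_eq0 Py)->]; first exact: mul0r.
  exact: mulr0.
by apply: eq_bigr => z /and3P[_ -> _]; rewrite mul1r.
Qed.

(** * Chains sorted by their bottom element *)

Lemma card_tuple_cons (A : pred (seq T)) n :
  #|[set c : n.+1.-tuple T | A c]|
    = (\sum_x #|[set t : n.-tuple T | A (x :: t)]|)%N.
Proof.
under eq_bigr do rewrite -sum1_card.
rewrite -sum1_card pair_big_dep /=.
rewrite (reindex (fun u : T * n.-tuple T => cons_tuple u.1 u.2)) /=.
  by apply: eq_bigl => -[x t]; rewrite !inE.
exists (fun c : n.+1.-tuple T => (thead c, behead_tuple c)) => /= [[x t] _|c _].
  by congr (_, _); apply: val_inj.
by rewrite [RHS]tuple_eta; apply: val_inj.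
Qed.

(** The tuple omits the bottom [x], so [i] is the dimension of the simplex [x :: t]. *)
Definition nchains Q i x : nat :=
  #|[set t : i.-tuple T | all [in Q] t & path <%O x t]|.

Lemma nchains0 Q x : nchains Q 0 x = 1%N.
Proof.
rewrite /nchains (_ : [set _ | _] = setT) ?cardsT ?card_tuple //.
by apply/setP=> t; rewrite !inE tuple0.
Qed.

Lemma nchainsS Q i x :
  nchains Q i.+1 x = (\sum_(z in Q | (x < z)%O) nchains Q i z)%N.
Proof.
rewrite /nchains (card_tuple_cons (fun t => all [in Q] t && path <%O x t)).
rewrite [RHS]big_mkcond; apply: eq_bigr => z _ /=.
case: ifP => [/andP[-> ->] //|nz]; apply/eqP; rewrite cards_eq0.
by apply/eqP/setP=> t; rewrite !inE andbACA nz.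
Qed.

Lemma card_simplices Q i : #|simplices Q i| = (\sum_(x in Q) nchains Q i x)%N.
Proof.
rewrite /simplices (card_tuple_cons (fun t => all [in Q] t && sorted <%O t)).
rewrite [RHS]big_mkcond; apply: eq_bigr => z _ /=.
case: ifP => [_ //|_]; apply/eqP; rewrite cards_eq0.
by apply/eqP/setP=> t; rewrite !inE.
Qed.

(** For [x] in [Q], the share of the Euler characteristic due to the simplices with bottom [x]. *)
Definition chain_sum Q x : int :=
  \sum_(i < #|Q|) (-1) ^+ i * (nchains Q i x)%:Z.

Lemma euler_char_chain_sum Q : euler_char Q = \sum_(x in Q) chain_sum Q x.
Proof.
rewrite exchange_big; apply: eq_bigr => i _ /=.
by rewrite card_simplices -mulr_sumr; congr (_ * _); rewrite -natz natr_sum;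
   apply: eq_bigr => x _; rewrite natz.
Qed.

(** A chain with bottom [x] is [x] alone or [x] followed by a chain with bottom [z > x], whose
    dimension is one less; hence the sign. *)
Lemma chain_sumE Q x : x \in Q ->
  chain_sum Q x = 1 - \sum_(z in Q | (x < z)%O) chain_sum Q z.
Proof.
(* No chain has more than [#|Q|] elements, so one more dimension can be added to the sum; removing
   the bottom then lands on the original range. *)
move=> Qx; have nc0 : nchains Q #|Q| x = 0%N.
  have := card_simplices Q #|Q|.
  by rewrite simplices_eq0 // cards0 (bigD1 x) //=; case: nchains.
have -> : chain_sum Q x = \sum_(i < #|Q|.+1) (-1) ^+ i * (nchains Q i x)%:Z.
  by rewrite big_ord_recr /= nc0 mulr0 addr0.
rewrite big_ord_recl /= nchains0 expr0 mul1r; congr (_ + _).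
rewrite exchange_big -sumrN; apply: eq_bigr => i _ /=.
rewrite nchainsS -mulr_sumr exprS mulN1r mulNr -natz natr_sum.
by congr (- (_ * _)); apply: eq_bigr => z _; rewrite natz.
Qed.

(** By induction on the number of elements of [Q] above [x], the recursion determines its solution
    on [Q], which is [chain_sum]. *)
Lemma euler_char_uniq Q (f : T -> int) :
    {in Q, forall x, f x = 1 - \sum_(z in Q | (x < z)%O) f z} ->
  euler_char Q = \sum_(x in Q) f x.
Proof.
move=> fE; rewrite euler_char_chain_sum; apply: eq_bigr => x.
have [n] := ubnP #|[set z in Q | (x < z)%O]|.
elim: n x => // n IHn x le_n Qx.
rewrite chain_sumE // fE //; congr (_ - _); apply: eq_bigr => z /andP[Qz xz].
apply: IHn => //; rewrite ltnS in le_n; apply: leq_trans le_n.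
apply/proper_card/properP; split.
  by apply/subsetP=> t; rewrite !inE => /andP[->] /(lt_trans xz).
by exists z; rewrite !inE Qz ?xz ?ltxx.
Qed.

(** In the vanishing sum of [mobius P z y] over [[x, y]], the term [z = y] is 1, and the [z]
    strictly between [x] and [y] are the elements of [Q] above [x]. So the negated Moebius function
    solves the chain recursion. *)
Lemma euler_char_upset P Q y : y \in P -> Q \subset P ->
    {in Q, forall x, (x < y)%O} ->
    {in Q, forall x z, z \in P -> (x <= z)%O -> (z < y)%O -> z \in Q} ->
  euler_char Q = - \sum_(x in Q) mobius P x y.
Proof.
move=> Py sQP Qy Qup; rewrite -sumrN; apply: euler_char_uniq => x Qx.
have Px := subsetP sQP x Qx; have xy := Qy x Qx.
have := sum_mobius_r Px Py xy.
rewrite (bigD1 y) /=; last by rewrite Py lexx (ltW xy).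
rewrite mobius_xx // (bigD1 x) /=; last by rewrite Px lexx (ltW xy) (lt_eqF xy).
move=> /eqP; rewrite addrA addrAC addr_eq0 => /eqP e.
rewrite sumrN opprK -e; congr (_ + _).
apply: eq_bigl => z; apply/idP/idP.
  case/andP=> /andP[/and3P[Pz xz zy] ney] nex.
  have zly : (z < y)%O by rewrite lt_neqAle ney.
  by rewrite (Qup x Qx z) //= lt_neqAle eq_sym nex.
case/andP=> Qz xz.
have zy := Qy z Qz.
by rewrite (subsetP sQP) // (ltW xz) (ltW zy) (lt_eqF zy) (gt_eqF xz).
Qed.

End MobiusEulerChar.

(** * Sums over subgroups lying above a fixed one *)

Section CyclicSubgroups.
Variable gT : finGroupType.
Implicit Types C G N X : {group gT}.

(** Each element of [X] generates exactly one cyclic subgroup, and a cyclic [C] has [totient #|C|]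
    generators. *)
Lemma sum_totient_cyclic X :
  (\sum_(C : {group gT} | cyclic C && (C \subset X)) totient #|C| = #|X|)%N.
Proof.
rewrite -sum1_card.
rewrite (partition_big (fun x => <[x]>%G)
  (fun C : {group gT} => cyclic C && (C \subset X))) /=; last first.
  by move=> x Xx; rewrite cycle_cyclic cycle_subG.
apply: eq_bigr => C /andP[/cyclicP[a Ca] sCX].
rewrite Ca -/(order a) totient_gen -sum1_card; apply: eq_bigl => x.
rewrite inE /generator -Ca [RHS]andbC; apply/eqP/andP => [eCx|[/eqP <-] //].
by split; [exact/eqP/val_inj/esym | rewrite -cycle_subG -eCx].
Qed.

Lemma sum_mobius_not_sub G N C :
    C \subset G -> ~~ (C \subset N) -> C != G ->
  \sum_(X : {group gT} | [&& C \subset X, X \subset G & ~~ (X \subset N)])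
     mobius (subgroups G) X G = 0.
Proof.
move=> sCG nCN neCG.
have ltCG : (C < G)%O by rewrite lt_neqAle neCG.
have [GG GC] : G \in subgroups G /\ C \in subgroups G by rewrite !inE.
apply: etrans (sum_mobius_r GC GG ltCG).
apply: eq_bigl => X; rewrite inE !le_groupE.
case sCX: (C \subset X); rewrite ?andbF //=.
case: (X \subset G) => //=.
by apply: contra nCN; apply: subset_trans.
Qed.

(** The term [X = G] gives 1; the others range over [TC G N C], which is upward closed among the
    proper subgroups of [G]. *)
Lemma sum_mobius_sub G N C :
    ~~ (G \subset N) -> C \subset G ->
  \sum_(X : {group gT} | [&& C \subset X, X \subset G & ~~ (X \subset N)])
     mobius (subgroups G) X G = 1 - euler_char (TC G N C).
Proof.
move=> nGN sCG; have GG : G \in subgroups G by rewrite inE.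
rewrite (euler_char_upset GG) //.
- rewrite opprK (bigD1 G) /= ?sCG ?subxx // mobius_xx //; congr (_ + _).
  apply: eq_bigl => X; rewrite inE -lt_groupE lt_neqAle le_groupE.
  by case: (C \subset X); case: (X \subset G); case: (X \subset N);
     case: (X != G).
- by apply/subsetP=> X; rewrite !inE => /and3P[_ /proper_sub].
- by move=> X; rewrite inE => /and3P[].
move=> X; rewrite !inE => /and3P[sCX _ nXN] Z _; rewrite le_groupE => sXZ.
rewrite lt_groupE inE => ->; rewrite (subset_trans sCX sXZ) /=.
by apply: contra nXN; apply: subset_trans.
Qed.

End CyclicSubgroups.

Theorem theorem1p3 (gT : finGroupType) (G N : {group gT}) (p : nat)
    (G_ncyclic : ~~ cyclic G) (nNG : (N <| G)%g)
    (p_prime : prime p) (indexGN : #|G : N|%g = p) :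
  m_ratio G N =
    #|G|%:R^-1 *
    \sum_(C : {group gT} | (C \subset N) && cyclic C)
       (1 - (euler_char (TC G N C))%:~R) * (totient #|C|)%:R.
Proof.
have sNG := normal_sub nNG.
have maxN : maximal N G by apply: p_index_maximal; rewrite ?indexGN.
have nGN : ~~ (G \subset N) by have /maxgroupp/andP[] := maxN.
rewrite /m_ratio; congr (_ * _).
transitivity (\sum_(X : {group gT} | (X \subset G) && ~~ (X \subset N))
    \sum_(C : {group gT} | cyclic C && (C \subset X))
      (totient #|C|)%:R * (mobius (subgroups G) X G)%:~R : rat).
  apply: eq_big => [X|X _].
    (* If [X] lies in [N] then [XN = N], which is not [G]; otherwise [XN = NX] is [G] by maximality
       of [N]. *)
    case sXG: (X \subset G) => //=; apply/eqP/idP => [eXN|nXN].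
      by apply: contra nGN => sXN; rewrite -eXN mulSGid.
    rewrite (normC (subset_trans sXG (normal_norm nNG))).
    exact: mulg_normal_maximal.
  by rewrite -mulr_suml -natr_sum sum_totient_cyclic.
rewrite (exchange_big_dep (fun C : {group gT} => cyclic C && (C \subset G))) /=;
  last first.
  by move=> X C /andP[sXG _] /andP[-> sCX]; rewrite (subset_trans sCX).
transitivity (\sum_(C : {group gT} | cyclic C && (C \subset G))
    (totient #|C|)%:R *
    (\sum_(X : {group gT} | [&& C \subset X, X \subset G & ~~ (X \subset N)])
       mobius (subgroups G) X G)%:~R : rat).
  apply: eq_bigr => C /andP[cC _]; rewrite -mulr_sumr rmorph_sum; congr (_ * _).
  by apply: eq_bigl => X; rewrite cC /= andbC.
rewrite (bigID (fun C : {group gT} => C \subset N)) /=.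
rewrite [X in _ + X]big1 ?addr0 => [|C /andP[/andP[cC sCG] nCN]]; last first.
  rewrite sum_mobius_not_sub ?mulr0 //.
  (* [C] is cyclic and [G] is not, so they differ. *)
  by apply: contraNneq G_ncyclic => <-.
apply: eq_big => [C|C /andP[/andP[_ sCG] _]].
  by case sCN: (C \subset N); rewrite ?andbF // (subset_trans sCN sNG) !andbT.
by rewrite sum_mobius_sub // rmorphB rmorph1 mulrC.
Qed.
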